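(* Let $\bar x\in\mathcal{F}$ and assume that there exist $\lambda^L=(\lambda^L_1,\ldots,\lambda^L_m),\ \lambda^U=(\lambda^U_1,\ldots,\lambda^U_m)\in \mathbb{R}^m_+$ with $\sum_{i\in I}(\lambda_i^L+\lambda_i^U)=1$, and $\mu\in A(\bar x)$ satisfying $$0\in \sum_{i\in I} \left[\lambda^L_i\partial f^L_i(\bar x)+\lambda^U_i\partial f_i^U(\bar x)\right] +\sum_{t\in T}\mu_t\partial g_t(\bar x)+\sum_{i\in I}\left(\lambda^L_i\epsilon^U_i+\lambda^U_i\epsilon^L_i\right)\mathbb{B}_{\mathbb{R}^n}+N(\bar x; \Omega).$$ (i) If $(f,g_T)$ is $\mathcal{E}$-pseudo-quasi generalized convex on $\Omega$ at $\bar x$, then $\bar x$ is a type-2 $\mathcal{E}$-quasi-weakly Pareto solution of (SIVP). (ii) If $(f,g_T)$ is strictly $\mathcal{E}$-pseudo-quasi generalized convex on $\Omega$ at $\bar x$, then $\bar x$ is a type-1 $\mathcal{E}$-quasi Pareto solution of (SIVP), and therefore $\bar x$ is also a type-2 $\mathcal{E}$-quasi Pareto solution and a type-1 $\mathcal{E}$-quasi-weakly Pareto solution of (SIVP).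
   Context: **Generalized differentiation.** $\mathbb{R}^n$ carries the usual scalar product and Euclidean norm; $\mathbb{B}_{\mathbb{R}^n}$ is its closed unit ball; $\mathbb{R}^m_+$ is the nonnegative orthant. For $S\subset\mathbb{R}^n$, $x\in S$ and $\varepsilon\ge 0$, let $\widehat N_\varepsilon(x;S)=\{z^*\in\mathbb{R}^n : \limsup_{u\to x,\,u\in S}\frac{\langle z^*,u-x\rangle}{\|u-x\|}\le\varepsilon\}$. The Mordukhovich (limiting) normal cone of $S$ at $\bar x\in\mathrm{cl}\,S$ is $$N(\bar x;S)=\{z^*\in\mathbb{R}^n : \exists\, x^k\to\bar x \text{ with } x^k\in S,\ \varepsilon_k\to0^+,\ z_k^*\to z^*,\ z^*_k\in\widehat N_{\varepsilon_k}(x^k;S)\ \forall k\in\mathbb{N}\}.$$ The Mordukhovich (limiting) subdifferential of $\varphi:\mathbb{R}^n\to\mathbb{R}$ at $\bar x$ is $\partial\varphi(\bar x)=\{x^*\in\mathbb{R}^n : (x^*,-1)\in N((\bar x,\varphi(\bar x));\mathrm{epi}\,\varphi)\}$, where $\mathrm{epi}\,\varphi=\{(x,\alpha)\in\mathbb{R}^n\times\mathbb{R}:\alpha\ge\varphi(x)\}$. For a cone $K\subset\mathbb{R}^n$, $K^\circ=\{\nu\in\mathbb{R}^n : \langle z,\nu\rangle\le0\ \forall z\in K\}$ is its polar. **Intervals.** $\mathcal{K}_c$ is the set of closed bounded intervals $[a^L,a^U]$, $a^L\le a^U$, in $\mathbb{R}$. For $A=[a^L,a^U]$, $B=[b^L,b^U]$: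 $A-B=[a^L-b^U,a^U-b^L]$; $kA=[ka^L,ka^U]$ for $k\ge0$. $A\le_{LU}B$ means $a^L\le b^L$ and $a^U\le b^U$; $A<_{LU}B$ means $A\le_{LU}B$ and $A\ne B$; $A<^s_{LU}B$ means $a^L<b^L$ and $a^U<b^U$. **Problem.** $I=\{1,\ldots,m\}$. For $i\in I$, $f_i:\mathbb{R}^n\to\mathcal{K}_c$, $f_i(x)=[f_i^L(x),f_i^U(x)]$, where $f_i^L,f_i^U:\mathbb{R}^n\to\mathbb{R}$ are locally Lipschitz with $f_i^L\le f_i^U$ on $\mathbb{R}^n$. $T$ is an arbitrary (possibly infinite) index set, $g_t:\mathbb{R}^n\to\mathbb{R}$ ($t\in T$) are locally Lipschitz, $g_T=(g_t)_{t\in T}$, and $\Omega\subset\mathbb{R}^n$ is nonempty and closed. Problem (SIVP) is to minimize, in the lower-upper (LU) interval order sense, $f=(f_1,\ldots,f_m)$ over the feasible set $\mathcal{F}=\{x\in\Omega : g_t(x)\le0,\ t\in T\}$. Fix reals $0\le\epsilon_i^L\le\epsilon_i^U$ ($i\in I$), $\mathcal{E}_i=[\epsilon_i^L,\epsilon_i^U]$, $\mathcal{E}=(\mathcal{E}_1,\ldots,\mathcal{E}_m)$. **Multipliers.** $\mathbb{R}_+^{|T|}$ is the set of functions $\mu:T\to\mathbb{R}_+$, $\mu_t=\mu(t)$, that vanish at all but finitely many $t\in T$. For $\bar x\in\Omega$, $A(\bar x)=\{\mu\in\mathbb{R}_+^{|T|} : \mu_tg_t(\bar x)=0\ \forall t\in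 T\}$. **Solutions.** A point $\bar x\in\mathcal{F}$ is, for (SIVP): - a type-1 $\mathcal{E}$-quasi Pareto solution if there is no $x\in\mathcal{F}$ with $f_i(x)\le_{LU}f_i(\bar x)-\mathcal{E}_i\|x-\bar x\|$ for all $i\in I$ and $f_k(x)<_{LU}f_k(\bar x)-\mathcal{E}_k\|x-\bar x\|$ for at least one $k\in I$; - a type-2 $\mathcal{E}$-quasi Pareto solution if there is no $x\in\mathcal{F}$ with $f_i(x)\le_{LU}f_i(\bar x)-\mathcal{E}_i\|x-\bar x\|$ for all $i\in I$ and $f_k(x)<^s_{LU}f_k(\bar x)-\mathcal{E}_k\|x-\bar x\|$ for at least one $k\in I$; - a type-1 $\mathcal{E}$-quasi-weakly Pareto solution if there is no $x\in\mathcal{F}$ with $f_i(x)<_{LU}f_i(\bar x)-\mathcal{E}_i\|x-\bar x\|$ for all $i\in I$; - a type-2 $\mathcal{E}$-quasi-weakly Pareto solution if there is no $x\in\mathcal{F}$ with $f_i(x)<^s_{LU}f_i(\bar x)-\mathcal{E}_i\|x-\bar x\|$ for all $i\in I$. **Generalized convexity.** $(f,g_T)$ is $\mathcal{E}$-pseudo-quasi generalized convex on $\Omega$ at $\bar x\in\Omega$ if for any $x\in\Omega$, $z_i^{*L}\in\partial f_i^L(\bar x)$, $z_i^{*U}\in\partial f_i^U(\bar x)$ ($i\in I$), and $x_t^*\in\partial g_t(\bar x)$ ($t\in T$), there exists $\nu\in[N(\bar x;\Omega)]^\circ$ such that (a) $\langle z_i^{*L},\nu\rangle+\epsilon_i^U\|x-\bar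 x\|\ge0\Rightarrow f_i^L(x)\ge f_i^L(\bar x)-\epsilon_i^U\|x-\bar x\|$ for all $i\in I$; (b) $\langle z_i^{*U},\nu\rangle+\epsilon_i^L\|x-\bar x\|\ge0\Rightarrow f_i^U(x)\ge f_i^U(\bar x)-\epsilon_i^L\|x-\bar x\|$ for all $i\in I$; (c) $g_t(x)\le g_t(\bar x)\Rightarrow\langle x_t^*,\nu\rangle\le0$ for all $t\in T$; (d) $\langle b^*,\nu\rangle\le\|x-\bar x\|$ for all $b^*\in\mathbb{B}_{\mathbb{R}^n}$. It is strictly $\mathcal{E}$-pseudo-quasi generalized convex on $\Omega$ at $\bar x$ if the same holds for any $x\in\Omega\setminus\{\bar x\}$ (and any such $z_i^{*L},z_i^{*U},x_t^*$), with the concluding inequalities $\ge$ in (a) and (b) (those for $f_i^L(x)$ and $f_i^U(x)$) replaced by strict inequalities $>$. *)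

(* Defs.v *)
From HB Require Import structures.
From mathcomp Require Import all_boot all_order all_algebra.
From mathcomp Require Import all_classical all_reals all_analysis.
Set Implicit Arguments.
Unset Strict Implicit.
Unset Printing Implicit Defensive.
Import Order.TTheory GRing.Theory Num.Theory.
Import numFieldNormedType.Exports.
Local Open Scope classical_set_scope.
Local Open Scope ring_scope.

(* R^n is 'rV[R]_n. Its library topology is the usual one, but its library norm
   `|x| is the sup norm, so the Euclidean structure is introduced here. *)
Section Euclidean.
Context {R : realType} {n : nat}.
Implicit Types (u v x : 'rV[R]_n) (A B S K : set 'rV[R]_n).

Definition dotp u v : R := \sum_(i < n) u 0 i * v 0 i.

Definition enorm u : R := Num.sqrt (dotp u u).

Lemma enorm_ge0 u : 0 <= enorm u.
Proof. exact: sqrtr_ge0. Qed.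

Definition eball : set 'rV[R]_n := [set b | enorm b <= 1].

Definition locally_lipschitz (phi : 'rV[R]_n -> R) : Prop :=
  forall x, exists L : R,
    \forall u \near x & v \near x, `|phi u - phi v| <= L * enorm (u - v).

Definition polar K : set 'rV[R]_n :=
  [set nu | forall z, K z -> dotp z nu <= 0].

(* The limsup is over the trace on S `\ x of the neighbourhoods of x; it is -oo
   when x is isolated in S. *)
Definition eps_normals (eps : R) S x : set 'rV[R]_n :=
  [set z | (limf_esup (fun u => (dotp z (u - x) / enorm (u - x))%:E)
              (within (S `\ x) (nbhs x)) <= eps%:E)%E].

Definition normal_cone S x : set 'rV[R]_n :=
  [set z | exists (xk : nat -> 'rV[R]_n) (eps : nat -> R) (zk : nat -> 'rV[R]_n),
    [/\ xk @ \oo --> x, eps @ \oo --> (0 : R), zk @ \oo --> z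
      & forall k, [/\ S (xk k), 0 < eps k & eps_normals (eps k) S (xk k) (zk k)]]].

Definition set_scale (c : R) A : set 'rV[R]_n := [set c *: a | a in A].

Definition set_add A B : set 'rV[R]_n := [set a + b | a in A & b in B].

(* Minkowski sum of the S i for i in D; meant for finite D. *)
Definition set_sum (I : choiceType) (D : set I) (S : I -> set 'rV[R]_n)
    : set 'rV[R]_n :=
  [set \sum_(i \in D) w i | w in [set w : I -> 'rV[R]_n | forall i, D i -> S i (w i)]].

End Euclidean.

(* R^n x R is R^(n+1), with the real component last. *)
Definition pair_rv (R : realType) (n : nat) (x : 'rV[R]_n) (a : R)
  : 'rV[R]_(n + 1) := row_mx x (a%:M).

Definition epi (R : realType) (n : nat) (phi : 'rV[R]_n -> R)
    : set 'rV[R]_(n + 1) :=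
  [set pair_rv p.1 p.2 | p in [set p : 'rV[R]_n * R | phi p.1 <= p.2]].

Definition subdiff (R : realType) (n : nat) (phi : 'rV[R]_n -> R)
    (x : 'rV[R]_n) : set 'rV[R]_n :=
  [set z | normal_cone (epi phi) (pair_rv x (phi x)) (pair_rv z (-1))].

Section Intervals.
Context {R : realType}.

Record cint := CInt { lo : R; up : R; lo_le_up : lo <= up }.

Implicit Types A B : cint.

Fact cint_sub_subproof A B : lo A - up B <= up A - lo B.
Proof. exact: lerB (lo_le_up A) (lo_le_up B). Qed.

Definition cint_sub A B : cint := CInt (cint_sub_subproof A B).

Fact cint_scale_subproof (k : R) (k0 : 0 <= k) A : k * lo A <= k * up A.
Proof. exact: ler_wpM2l k0 _ _ (lo_le_up A). Qed.

Definition cint_scale (k : R) (k0 : 0 <= k) A : cint :=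
  CInt (cint_scale_subproof k0 A).

Definition le_LU A B : Prop := lo A <= lo B /\ up A <= up B.

Definition lt_LU A B : Prop := le_LU A B /\ A <> B.

Definition lts_LU A B : Prop := lo A < lo B /\ up A < up B.

End Intervals.
Arguments cint : clear implicits.

Section Problem.
Context {R : realType} {n m : nat} {T : Type}.
Implicit Types (f : 'I_m -> 'rV[R]_n -> cint R) (g : T -> 'rV[R]_n -> R).
Implicit Types (Omega F : set 'rV[R]_n) (E : 'I_m -> cint R) (x xbar : 'rV[R]_n).

Definition feasible g Omega : set 'rV[R]_n :=
  [set x | Omega x /\ forall t, g t x <= 0].

(* f_i(xbar) - E_i ||x - xbar|| *)
Definition shifted f E xbar x (i : 'I_m) : cint R :=
  cint_sub (f i xbar) (cint_scale (enorm_ge0 (x - xbar)) (E i)).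

Definition type1_quasi_pareto f E F xbar : Prop :=
  F xbar /\ ~ exists x, [/\ F x,
    forall i, le_LU (f i x) (shifted f E xbar x i)
    & exists k, lt_LU (f k x) (shifted f E xbar x k)].

Definition type2_quasi_pareto f E F xbar : Prop :=
  F xbar /\ ~ exists x, [/\ F x,
    forall i, le_LU (f i x) (shifted f E xbar x i)
    & exists k, lts_LU (f k x) (shifted f E xbar x k)].

Definition type1_quasi_weakly_pareto f E F xbar : Prop :=
  F xbar /\ ~ exists x,
    F x /\ forall i, lt_LU (f i x) (shifted f E xbar x i).

Definition type2_quasi_weakly_pareto f E F xbar : Prop :=
  F xbar /\ ~ exists x,
    F x /\ forall i, lts_LU (f i x) (shifted f E xbar x i).

Definition pseudo_quasi_gconvex f g E Omega xbar : Prop :=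
  forall x (zL zU : 'I_m -> 'rV[R]_n) (xs : T -> 'rV[R]_n),
  Omega x ->
  (forall i, subdiff (fun y => lo (f i y)) xbar (zL i)) ->
  (forall i, subdiff (fun y => up (f i y)) xbar (zU i)) ->
  (forall t, subdiff (g t) xbar (xs t)) ->
  exists2 nu, polar (normal_cone Omega xbar) nu &
  [/\ forall i, 0 <= dotp (zL i) nu + up (E i) * enorm (x - xbar) ->
        lo (f i x) >= lo (f i xbar) - up (E i) * enorm (x - xbar),
      forall i, 0 <= dotp (zU i) nu + lo (E i) * enorm (x - xbar) ->
        up (f i x) >= up (f i xbar) - lo (E i) * enorm (x - xbar),
      forall t, g t x <= g t xbar -> dotp (xs t) nu <= 0
    & forall b, eball b -> dotp b nu <= enorm (x - xbar)].

Definition strict_pseudo_quasi_gconvex f g E Omega xbar : Prop :=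
  forall x (zL zU : 'I_m -> 'rV[R]_n) (xs : T -> 'rV[R]_n),
  Omega x -> x <> xbar ->
  (forall i, subdiff (fun y => lo (f i y)) xbar (zL i)) ->
  (forall i, subdiff (fun y => up (f i y)) xbar (zU i)) ->
  (forall t, subdiff (g t) xbar (xs t)) ->
  exists2 nu, polar (normal_cone Omega xbar) nu &
  [/\ forall i, 0 <= dotp (zL i) nu + up (E i) * enorm (x - xbar) ->
        lo (f i x) > lo (f i xbar) - up (E i) * enorm (x - xbar),
      forall i, 0 <= dotp (zU i) nu + lo (E i) * enorm (x - xbar) ->
        up (f i x) > up (f i xbar) - lo (E i) * enorm (x - xbar),
      forall t, g t x <= g t xbar -> dotp (xs t) nu <= 0
    & forall b, eball b -> dotp b nu <= enorm (x - xbar)].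

Definition multipliers g xbar : set (T -> R) :=
  [set mu | [/\ forall t, 0 <= mu t, finite_set [set t | mu t != 0]
              & forall t, mu t * g t xbar = 0]].

(* As mu vanishes off a finite set, the sum over T runs over the support of mu;
   {classic T} is T with a choice structure, as finite sums over T require. *)
Definition kkt_set f g E Omega xbar (lamL lamU : 'I_m -> R) (mu : T -> R)
    : set 'rV[R]_n :=
  set_add (set_add (set_add
    (set_sum [set: 'I_m] (fun i =>
       set_add (set_scale (lamL i) (subdiff (fun y => lo (f i y)) xbar))
               (set_scale (lamU i) (subdiff (fun y => up (f i y)) xbar))))
    (set_sum (I := {classic T}) [set t | mu t != 0] (fun t => set_scale (mu t) (subdiff (g t) xbar))))
    (set_scale (\sum_(i < m) (lamL i * up (E i) + lamU i * lo (E i))) eball))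
    (normal_cone Omega xbar).

End Problem.

(* Main.v *)
Require Import Defs.
From mathcomp Require Import all_boot all_order all_algebra.
From mathcomp Require Import all_classical all_reals all_analysis.
From mathcomp Require Import ring lra.

Import Order.TTheory GRing.Theory Num.Theory.
Import numFieldNormedType.Exports.

(** Generalized convexity turns an inequality between values of the objectives
    into a sign condition on scalar products with a direction [nu]. If a feasible
    [x] were better than [xbar] in the sense at stake, the contrapositives of the
    two implications on [f] would make every number
    [dotp (zL i) nu + up (E i) * enorm (x - xbar)] and
    [dotp (zU i) nu + lo (E i) * enorm (x - xbar)] negative, whatever the
    subgradients [zL i], [zU i]. In the strict version this already follows from
    weak domination, with [x <> xbar]; domination at [xbar] itself is excluded
    since an interval is not strictly below itself. Weighted by [lamL] and
    [lamU], which sum to 1, these numbers have a negative sum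
    ([weighted_sum_lt0]). But for the subgradients occurring in the multiplier
    rule, the scalar product of that rule with [nu] shows that the same sum is
    nonnegative ([multiplier_sum_ge0]): [nu] is polar to the normal cone, has
    product at most [enorm (x - xbar)] with the unit ball, and has nonpositive
    product with the subgradients of the constraints active at [xbar].

    The delicate point is that generalized convexity yields [nu] only for a
    choice of subgradients of all the [g t], whereas the multiplier rule provides
    them for finitely many [t]. The choice is completed with [subdiff_neq0]: a
    locally Lipschitz function on a finite-dimensional space has a nonempty
    limiting subdifferential at every point. Its proof minimizes the function
    plus a steep quadratic around [x], which gives uniformly bounded proximal
    subgradients at points tending to [x] ([prox_subgradient_dense]); proximal
    subgradients are normals to the epigraph ([prox_subgradient_eps_normals]),
    and compactness of balls provides a limit. *)

Set Implicit Arguments.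
Unset Strict Implicit.
Local Open Scope classical_set_scope.
Local Open Scope ring_scope.

(** * Euclidean norm and the topology of row vectors *)

Section EuclideanTheory.
Variables (R : realType) (n : nat).
Implicit Types (u v w x : 'rV[R]_n) (a b c e : R).

Lemma dotpC u v : dotp u v = dotp v u.
Proof. by apply: eq_bigr => i _; rewrite mulrC. Qed.

Lemma dotpDl u v w : dotp (u + v) w = dotp u w + dotp v w.
Proof. by rewrite -big_split; apply: eq_bigr => i _; rewrite mxE mulrDl. Qed.

Lemma dotpZl a u v : dotp (a *: u) v = a * dotp u v.
Proof. by rewrite /dotp mulr_sumr; apply: eq_bigr => i _; rewrite mxE mulrA. Qed.

Lemma dotp0l v : dotp 0 v = 0.
Proof. by rewrite -(scale0r 0) dotpZl mul0r. Qed.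

Lemma dotp_suml (I : Type) (r : seq I) (F : I -> 'rV[R]_n) v :
  dotp (\sum_(i <- r) F i) v = \sum_(i <- r) dotp (F i) v.
Proof.
apply: (big_morph (fun u => dotp u v)) => [u w|]; first exact: dotpDl.
exact: dotp0l.
Qed.

Lemma enorm_sqr u : enorm u ^+ 2 = dotp u u.
Proof. by rewrite sqr_sqrtr// sumr_ge0// => i _; rewrite -expr2 sqr_ge0. Qed.

Lemma enorm0 : enorm (0 : 'rV[R]_n) = 0.
Proof. by rewrite /enorm dotp0l sqrtr0. Qed.

Lemma enormZ a u : enorm (a *: u) = `|a| * enorm u.
Proof.
by rewrite /enorm dotpZl dotpC dotpZl mulrA -expr2 sqrtrM ?sqr_ge0// sqrtr_sqr.
Qed.

Lemma enormN u : enorm (- u) = enorm u.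
Proof. by rewrite -scaleN1r enormZ normrN1 mul1r. Qed.

Lemma norm_le_enorm u : `|u| <= enorm u.
Proof.
rewrite /Num.norm/= mx_normrE; apply: bigmax_le => [|[i j] _]; first exact: sqrtr_ge0.
rewrite (ord1 i) /= -sqrtr_sqr ler_wsqrtr// /dotp (bigD1 j)//= expr2 lerDl.
by apply: sumr_ge0 => k _; rewrite -expr2 sqr_ge0.
Qed.

Lemma enorm_continuous : continuous (@enorm R n).
Proof.
move=> u; apply: (@continuous_comp _ _ _ (fun v => dotp v v) Num.sqrt); last first.
  exact: sqrt_continuous.
apply: (@continuous_big R _ +%R 0 predT) => [|i _ v]; first exact: add_continuous.
have cv : (fun w : 'rV[R]_n => w 0 i) @ v --> v 0 i by apply: coord_continuous.
exact: (cvgM cv cv).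
Qed.

Lemma enorm_dist_continuous x : continuous (fun u => enorm (u - x)).
Proof.
move=> u; apply: (@continuous_comp _ _ _ (fun v => v - x) (@enorm R n)).
  by apply: (@continuousB _ _ _ id (cst x)); [exact: cvg_id | exact: cst_continuous].
exact: enorm_continuous.
Qed.

(** The topology of row vectors comes from the sup norm; this lets it be
    handled through Euclidean balls alone. One direction is [norm_le_enorm],
    the other is the continuity of [enorm]. *)
Lemma nbhs_enormP x (A : set 'rV[R]_n) :
  nbhs x A <-> exists2 e, 0 < e & forall u, enorm (u - x) < e -> A u.
Proof.
split=> [/nbhs_ballP[e /= e0 eA]|[e e0 eA]].
  exists e => // u ue; apply: eA; rewrite mx_norm_ball /ball_/=.
  by rewrite distrC; exact: le_lt_trans (norm_le_enorm _) ue.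
have := @enorm_dist_continuous x x.
rewrite /continuous_at subrr enorm0 => /cvgr_lt /(_ _ e0).
by apply: filterS => u /=; exact: eA.
Qed.

Lemma compact_enorm_ball x c : compact [set u : 'rV[R]_n | enorm (u - x) <= c].
Proof.
apply: bounded_closed_compact; last first.
  exact: (preimage_closed (fun u _ => @enorm_dist_continuous x u) (@closed_le R c)).
exists (c + `|x|); split; first by rewrite num_real.
move=> M cM u /= ux; rewrite -(subrK x u) (le_trans (ler_normD _ _))//.
rewrite (le_trans _ (ltW cM))// lerD2r.
exact: le_trans (norm_le_enorm _) ux.
Qed.

Lemma cvg_enorm_inv (y : nat -> 'rV[R]_n) x :
  (forall k, enorm (y k - x) < k.+1%:R^-1) -> y @ \oo --> x.
Proof.
move=> yx A /nbhs_enormP[e e0 eA].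
have := near_infty_natSinv_lt (PosNum e0); apply: filterS => k /= ke.
by apply: eA; exact: lt_trans (yx k) ke.
Qed.

(** Holding one of the two points of the Lipschitz estimate fixed at [x]
    gives continuity at [x]. *)
Lemma locally_lipschitz_continuous (phi : 'rV[R]_n -> R) :
  locally_lipschitz phi -> continuous phi.
Proof.
move=> lip x; have [L /= [[A B] /= [Ax Bx] ABL]] := lip x.
suff : phi @ x --> phi x by [].
apply/(@cvgrPdist_lt _ _ _ (nbhs x) (nbhs_filter x)) => e e0.
have L0 : 0 < `|L| + 1 by rewrite ltr_wpDl.
have : nbhs x [set u | enorm (u - x) < e / (`|L| + 1)].
  by apply/nbhs_enormP; exists (e / (`|L| + 1)); rewrite ?divr_gt0.
apply: filterS2 Bx => u Bu /= ue.
have /= := ABL (x, u) (conj (nbhs_singleton Ax) Bu).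
move=> /le_lt_trans; apply; rewrite -enormN opprB.
move: ue; rewrite ltr_pdivlMr// mulrC.
apply: le_lt_trans; rewrite ler_wpM2r ?enorm_ge0//.
by rewrite (le_trans (ler_norm _))// lerDl.
Qed.

End EuclideanTheory.

Section Pairs.
Variables (R : realType) (n : nat).
Implicit Types (u v : 'rV[R]_n) (a b : R).

Lemma pair_rvB u v a b : pair_rv u a - pair_rv v b = pair_rv (u - v) (a - b).
Proof. by rewrite /pair_rv opp_row_mx add_row_mx raddfB. Qed.

Lemma dotp_pair u v a b : dotp (pair_rv u a) (pair_rv v b) = dotp u v + a * b.
Proof.
rewrite /dotp big_split_ord /= big_ord1; congr (_ + _).
  by apply: eq_bigr => i _; rewrite !row_mxEl.
by rewrite !row_mxEr !mxE eqxx !mulr1n.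
Qed.

Lemma enorm_pair_ge u a : enorm u <= enorm (pair_rv u a).
Proof. by rewrite /enorm ler_wsqrtr// dotp_pair lerDl -expr2 sqr_ge0. Qed.

(** Bounding both components by half the radius suffices, since the squared
    norm of a pair is the sum of the two squares. *)
Lemma cvg_pair_rv (y : nat -> 'rV[R]_n) (a : nat -> R) u b :
  y @ \oo --> u -> a @ \oo --> b ->
  (fun k => pair_rv (y k) (a k)) @ \oo --> pair_rv u b.
Proof.
move=> yu ab A /nbhs_enormP[e e0 eA].
have e2 : 0 < e / 2 by rewrite divr_gt0.
have /yu : nbhs u [set v | enorm (v - u) < e / 2].
  by apply/nbhs_enormP; exists (e / 2).
move/cvgrPdist_lt: ab => /(_ _ e2); apply: filterS2 => k /= ak yk.
apply: eA; rewrite pair_rvB.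
rewrite -(@ltr_pXn2r _ 2) ?nnegrE ?enorm_ge0 ?(ltW e0)// enorm_sqr dotp_pair.
rewrite -enorm_sqr -expr2 -[(a k - b) ^+ 2]real_normK ?num_real// distrC.
have := enorm_ge0 (y k - u); have := normr_ge0 (b - a k).
nra.
Qed.

End Pairs.

(** * Nonemptiness of the limiting subdifferential *)

Section Subdifferential.
Variables (R : realType) (n : nat).
Implicit Types (phi : 'rV[R]_n -> R) (x y z : 'rV[R]_n) (c : R).

(** A proximal subgradient: [phi] is supported near [y] by a paraboloid of
    curvature [c] whose slope at [y] is [z]. *)
Definition prox_subgradient phi y z c : Prop :=
  \forall u \near y, phi y + dotp z (u - y) - c * enorm (u - y) ^+ 2 <= phi u.

(** At a point [v] of the epigraph, the paraboloid bounds the product of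
    [(z, -1)] with [v - (y, phi y)] by [c] times the square of the distance, so
    the normal quotient is at most [c] times the distance, which is below [eps]
    close to [(y, phi y)]. *)
Lemma prox_subgradient_eps_normals phi y z c eps : 0 <= c -> 0 < eps ->
  prox_subgradient phi y z c ->
  eps_normals eps (epi phi) (pair_rv y (phi y)) (pair_rv z (-1)).
Proof.
move=> c0 eps0 /nbhs_enormP[d d0 dP]; set y' := pair_rv y (phi y).
have c1 : 0 < c + 1 by rewrite ltr_wpDl.
(* [c + 1] rather than [c], because the curvature may vanish. *)
set V := [set v | epi phi v /\ enorm (v - y') < Num.min d (eps / (c + 1))].
apply: (@le_trans _ _ (ereal_sup
  [set (dotp (pair_rv z (-1)) (v - y') / enorm (v - y'))%:E | v in V])).
  apply: ereal_inf_lbound; exists V => //=.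
  rewrite /within /=; apply/nbhs_enormP.
  exists (Num.min d (eps / (c + 1))); first by rewrite lt_min d0 divr_gt0.
  by move=> v vy [].
apply: ge_ereal_sup => _ [v [[[u al] /= ual <-]] + <-]; rewrite lt_min => /andP[].
set r := enorm _ => rd re; rewrite lee_fin.
have r0 : 0 <= r := enorm_ge0 _.
(* At the base point itself the quotient is 0, division by 0 being 0. *)
have [->|rn0] := eqVneq r 0; first by rewrite invr0 mulr0 ltW.
have ur : enorm (u - y) <= r by rewrite /r pair_rvB enorm_pair_ge.
have := dP _ (le_lt_trans ur rd); rewrite pair_rvB dotp_pair.
rewrite ler_pdivrMr ?lt_neqAle 1?eq_sym ?rn0// => main.
apply: (@le_trans _ _ (c * r ^+ 2)).
  have : c * enorm (u - y) ^+ 2 <= c * r ^+ 2.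
    by rewrite ler_wpM2l// ler_pXn2r// nnegrE enorm_ge0.
  lra.
rewrite expr2 mulrA ler_wpM2r//.
by move: re; rewrite ltr_pdivlMr//; nra.
Qed.

(** Minimize [phi u + c * enorm (u - x) ^+ 2] over a small closed ball. The
    minimizer [y] does no worse than [x], so
    [c * enorm (y - x) ^+ 2 <= phi x - phi y <= L * enorm (y - x)]; hence
    [c * enorm (y - x) <= L]. For large [c] this puts [y] in the open ball,
    where minimality says that [- (2 * c) *: (y - x)] is a proximal subgradient.
    Its norm is at most [2 * L], however large [c] has to be. *)
Lemma prox_subgradient_dense phi x L d e : continuous phi -> 0 <= L -> 0 < d ->
  (forall u, enorm (u - x) < d -> `|phi x - phi u| <= L * enorm (u - x)) ->
  0 < e ->
  exists y z c, [/\ enorm (y - x) < e, enorm z <= 2 * L, 0 <= c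
                  & prox_subgradient phi y z c].
Proof.
move=> cphi L0 d0 lip e0.
set r := Num.min (d / 2) e.
have r0 : 0 < r by rewrite lt_min e0 divr_gt0.
have rd : r < d by rewrite gt_min; apply/orP; left; lra.
have re : r <= e by rewrite ge_min lexx orbT.
(* Any [c] with [L < c * r] forces the minimizer off the boundary. *)
set c := (L + 1) / r.
have c0 : 0 < c by rewrite divr_gt0// ltr_wpDl.
pose psi u := phi u + c * enorm (u - x) ^+ 2.
have cpsi : continuous psi.
  move=> u; have du := @enorm_dist_continuous R n x u.
  exact: (cvgD (cphi u) (cvgM (cvg_cst c) (cvgM du du))).
have [|||y] := @EVT_min_rV R n psi [set u | enorm (u - x) <= r].
- by exists x; rewrite /= subrr enorm0 ltW.
- exact: compact_enorm_ball.
- exact: continuous_subspaceT.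
rewrite inE /= => yr ymin.
have cy : c * enorm (y - x) <= L.
  have := ymin x; rewrite inE /= subrr enorm0 /psi => /(_ (ltW r0)).
  rewrite subrr enorm0 expr0n mulr0 addr0 => yx.
  have := lip y (le_lt_trans yr rd) => /(le_trans (ler_norm _)) xy.
  have := enorm_ge0 (y - x); rewrite le_eqVlt => /orP[/eqP<-|ny]; first by rewrite mulr0.
  rewrite -(ler_pM2r ny); move: yx xy; rewrite expr2; lra.
have {}yr : enorm (y - x) < r.
  have : c * enorm (y - x) < c * r.
    by rewrite (le_lt_trans cy)// /c divfK ?gt_eqF// ltrDl.
  by rewrite ltr_pM2l.
exists y, (- (2 * c) *: (y - x)), c; split; [exact: lt_le_trans re| |exact: ltW|].
  rewrite enormZ normrN ger0_norm; last by rewrite mulr_ge0// ltW.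
  by rewrite -mulrA ler_wpM2l.
have : \forall u \near y, enorm (u - x) < r.
  have /cvgr_lt := @enorm_dist_continuous R n x y; exact.
apply: filterS => u ur.
have := ymin u; rewrite inE /= /psi => /(_ (ltW ur)).
have -> : u - x = (u - y) + (y - x) by rewrite addrA subrK.
move: (u - y) (y - x) => a k; rewrite !enorm_sqr dotpZl.
rewrite (_ : dotp (a + k) (a + k) = dotp a a + 2 * dotp k a + dotp k k); first lra.
by rewrite dotpDl !(dotpC _ (a + k)) !dotpDl (dotpC a k); ring.
Qed.

(** Proximal subgradients taken at points tending to [x] stay in a compact ball,
    so they have a cluster point; it is a limiting subgradient at [x], because
    the points of the graph converge along with their base points. *)
Lemma subdiff_neq0 phi x : locally_lipschitz phi -> subdiff phi x !=set0.
Proof.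
move=> lip; have cphi := @locally_lipschitz_continuous _ _ _ lip.
have [L0 /= [[A B] /= [Ax Bx] ABL]] := lip x.
have /nbhs_enormP[d d0 dB] := Bx.
set L := `|L0|.
have {ABL dB} lipx u : enorm (u - x) < d -> `|phi x - phi u| <= L * enorm (u - x).
  move=> ud; have /= := ABL (x, u) (conj (nbhs_singleton Ax) (dB _ ud)).
  move=> /le_trans; apply; rewrite -enormN opprB.
  by rewrite ler_wpM2r ?enorm_ge0// ler_norm.
have ex k : exists t : 'rV[R]_n * 'rV[R]_n * R,
    [/\ enorm (t.1.1 - x) < k.+1%:R^-1, enorm t.1.2 <= 2 * L, 0 <= t.2
       & prox_subgradient phi t.1.1 t.1.2 t.2].
  have [||y [z [c [? ? ? ?]]]] :=
      @prox_subgradient_dense phi x L d k.+1%:R^-1 cphi _ d0 lipx.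
  - exact: normr_ge0.
  - by rewrite invr_gt0.
  by exists (y, z, c).
have {ex}[t tP] := choice ex.
have [|z [_ zcl]] := @compact_enorm_ball R n 0 (2 * L)
    ((fun k => (t k).1.2) @ \oo) _.
  by exists 0%N => // k _ /=; rewrite subr0; case: (tP k).
have sub k : exists j, (k <= j)%N /\ enorm ((t j).1.2 - z) < k.+1%:R^-1.
  have [||_ [/= [j kj <-] jz]] := zcl [set (t j).1.2 | j in [set j | (k <= j)%N]]
      [set w | enorm (w - z) < k.+1%:R^-1].
  - by exists k => // j /= kj; exists j.
  - by apply/nbhs_enormP; exists k.+1%:R^-1; rewrite ?invr_gt0.
  by exists j.
(* [s k] need not increase: [k <= s k] is enough for convergence. *)
have {sub}[s sP] := choice sub.
have yx : (fun k => (t (s k)).1.1) @ \oo --> x.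
  apply: cvg_enorm_inv => k; have [ks _] := sP k.
  have [+ _ _ _] := tP (s k); move=> /lt_le_trans; apply.
  by rewrite lef_pV2 ?posrE// ler_nat ltnS.
exists z; exists (fun k => pair_rv (t (s k)).1.1 (phi (t (s k)).1.1)),
  (fun k => k.+1%:R^-1), (fun k => pair_rv (t (s k)).1.2 (-1)); split.
- apply: cvg_pair_rv => //.
  exact: (@cvg_comp _ _ _ (fun k => (t (s k)).1.1) phi _ (nbhs x) _ yx (cphi x)).
- exact: cvg_harmonic.
- apply: cvg_pair_rv; last exact: cvg_cst.
  by apply: cvg_enorm_inv => k; have [] := sP k.
- move=> k; split; last 2 first.
  + by rewrite invr_gt0.
  + have [_ _ c0 ?] := tP (s k).
    by apply: prox_subgradient_eps_normals c0 _ _; rewrite ?invr_gt0.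
  by exists ((t (s k)).1.1, phi (t (s k)).1.1) => /=.
Qed.

End Subdifferential.

(** * Sufficiency of the multiplier rule *)

Lemma cint_ext (R : realType) (A B : cint R) : lo A = lo B -> up A = up B -> A = B.
Proof.
case: A B => [a b ab] [a' b' ab'] /= ea eb; subst a' b'.
by rewrite (bool_irrelevance ab ab').
Qed.

Section KKT.
Variables (R : realType) (n m : nat) (T : Type).
Variables (f : 'I_m -> 'rV[R]_n -> cint R) (g : T -> 'rV[R]_n -> R).
Variables (Omega : set 'rV[R]_n) (E : 'I_m -> cint R) (xbar : 'rV[R]_n).
Variables (lamL lamU : 'I_m -> R) (mu : T -> R).

(** The inclusion supplies a subgradient of [g t] only for the [t] with
    [mu t != 0], while generalized convexity is tested against a whole family
    indexed by [T]. For the other [t] an arbitrary subgradient is inserted; one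
    exists because [g t] is locally Lipschitz. *)
Lemma kkt_certificate : (forall t, locally_lipschitz (g t)) ->
  kkt_set f g E Omega xbar lamL lamU mu 0 ->
  exists (zL zU : 'I_m -> 'rV[R]_n) (xs : {classic T} -> 'rV[R]_n)
         (b w : 'rV[R]_n),
  [/\ forall i, subdiff (fun y => lo (f i y)) xbar (zL i),
      forall i, subdiff (fun y => up (f i y)) xbar (zU i),
      forall t, subdiff (g t) xbar (xs t),
      eball b /\ normal_cone Omega xbar w
    & \sum_(i < m) (lamL i *: zL i + lamU i *: zU i)
      + \sum_(t \in [set t : {classic T} | mu t != 0]) mu t *: xs t
      + (\sum_(i < m) (lamL i * up (E i) + lamU i * lo (E i))) *: b + w = 0].
Proof.
move=> g_lip [_ [_ [_ [wf wfP <-] [_ [wg wgP <-] <-]] [_ [b bb <-] <-]] [w wN e0]].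
have exf i : exists z : 'rV[R]_n * 'rV[R]_n,
    [/\ subdiff (fun y => lo (f i y)) xbar z.1,
        subdiff (fun y => up (f i y)) xbar z.2
      & wf i = lamL i *: z.1 + lamU i *: z.2].
  have [_ [zl zlP <-] [_ [zu zuP <-] <-]] := wfP i I.
  by exists (zl, zu).
have exg (t : {classic T}) : exists z : 'rV[R]_n,
    subdiff (g t) xbar z /\ (mu t != 0 -> wg t = mu t *: z).
  have [mt|mt] := boolP (mu t != 0).
    by have [z zP <-] := wgP t mt; exists z.
  by have [z zP] := @subdiff_neq0 R n (g t) xbar (g_lip t); exists z.
have [z zP] := choice exf; have [xs xsP] := choice exg.
exists (fun i => (z i).1), (fun i => (z i).2), xs, b, w.
split=> [i|i|t||]; [by case: (zP i)|by case: (zP i)|by case: (xsP t)|by []|].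
rewrite -[RHS]e0; congr (_ + _ + _ + _).
  rewrite (fsbigE (index_enum 'I_m)) ?index_enum_uniq//; last first.
    by move=> i _; rewrite mem_index_enum.
  by apply: eq_big => i; [rewrite in_setT|case: (zP i)].
by apply: eq_fsbigr => t /set_mem mt; have [_ ->] := xsP t.
Qed.

(** Take the scalar product of the multiplier equation with [nu]. The
    constraint and normal terms contribute at most 0, and the ball term
    contributes at most [r] times its coefficient, which is exactly what the
    terms in [r] on the right add up to. *)
Lemma multiplier_sum_ge0 zL zU (xs : {classic T} -> 'rV[R]_n) b w nu r :
  finite_set [set t | mu t != 0] ->
  (forall t, 0 <= mu t) ->
  0 <= \sum_(i < m) (lamL i * up (E i) + lamU i * lo (E i)) ->
  \sum_(i < m) (lamL i *: zL i + lamU i *: zU i)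
      + \sum_(t \in [set t : {classic T} | mu t != 0]) mu t *: xs t
      + (\sum_(i < m) (lamL i * up (E i) + lamU i * lo (E i))) *: b + w = 0 ->
  (forall t, mu t != 0 -> dotp (xs t) nu <= 0) ->
  dotp b nu <= r -> dotp w nu <= 0 ->
  0 <= \sum_(i < m) (lamL i * (dotp (zL i) nu + up (E i) * r)
                     + lamU i * (dotp (zU i) nu + lo (E i) * r)).
Proof.
move=> fin mu0 c0 e0 xs0 br w0.
set c := \sum_(i < m) (lamL i * up (E i) + lamU i * lo (E i)) in e0 c0 |- *.
have -> : \sum_(i < m) (lamL i * (dotp (zL i) nu + up (E i) * r)
    + lamU i * (dotp (zU i) nu + lo (E i) * r)) =
    dotp (\sum_(i < m) (lamL i *: zL i + lamU i *: zU i)) nu + c * r.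
  rewrite dotp_suml mulr_suml -big_split; apply: eq_bigr => i _ /=.
  by rewrite dotpDl !dotpZl; ring.
move/(congr1 (fun u => dotp u nu)): e0.
rewrite dotp0l !dotpDl dotpZl.
have : dotp (\sum_(t \in [set t : {classic T} | mu t != 0]) mu t *: xs t) nu <= 0.
  rewrite fsbig_finite//= dotp_suml big_seq sumr_le0// => t.
  rewrite in_fset_set// => /set_mem /= mt.
  by rewrite dotpZl mulr_ge0_le0// xs0.
have := ler_wpM2l c0 br.
lra.
Qed.

End KKT.

Lemma weighted_sum_lt0 (R : realType) (m : nat) (lamL lamU a b : 'I_m -> R) :
  (forall i, 0 <= lamL i) -> (forall i, 0 <= lamU i) ->
  \sum_(i < m) (lamL i + lamU i) = 1 ->
  (forall i, a i < 0) -> (forall i, b i < 0) ->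
  \sum_(i < m) (lamL i * a i + lamU i * b i) < 0.
Proof.
move=> l0 u0 lu a0 b0.
have le0 i : true -> lamL i * a i + lamU i * b i <= 0.
  by move=> _; rewrite -[leRHS]addr0 lerD// mulr_ge0_le0// ltW.
rewrite lt_neqAle sumr_le0// andbT; apply/eqP => s0.
suff : \sum_(i < m) (lamL i + lamU i) = 0 by rewrite lu; apply/eqP; exact: oner_neq0.
apply: big1 => i _; apply/eqP.
have : - (lamL i * a i + lamU i * b i) == 0.
  have := s0 => /(congr1 -%R); rewrite oppr0 -sumrN => /eqP.
  rewrite psumr_eq0 => [|j _]; last by rewrite oppr_ge0 le0.
  by move=> /allP /(_ i (mem_index_enum _)).
rewrite oppr_eq0 => /eqP h; have := l0 i; have := u0 i.
move: h (a0 i) (b0 i) => /[swap] ai /[swap] bi h ui li.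
have := mulr_ge0_le0 li (ltW ai); have := mulr_ge0_le0 ui (ltW bi) => p q.
have /eqP : lamL i * a i = 0 by lra.
have /eqP : lamU i * b i = 0 by lra.
rewrite !mulf_eq0 (lt_eqF ai) (lt_eqF bi) !orbF => /eqP-> /eqP->.
by rewrite addr0.
Qed.

Unset Implicit Arguments.

Theorem theorem3p11 (R : realType) (n m : nat) (T : Type)
  (f : 'I_m -> 'rV[R]_n -> cint R) (g : T -> 'rV[R]_n -> R)
  (Omega : set 'rV[R]_n) (E : 'I_m -> cint R)
  (fL_lip : forall i, locally_lipschitz (fun x => lo (f i x)))
  (fU_lip : forall i, locally_lipschitz (fun x => up (f i x)))
  (g_lip : forall t, locally_lipschitz (g t))
  (Omega_neq0 : Omega !=set0) (Omega_closed : closed Omega)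
  (E_ge0 : forall i, 0 <= lo (E i))
  (xbar : 'rV[R]_n) (xbar_feas : feasible g Omega xbar)
  (lamL lamU : 'I_m -> R) (mu : T -> R)
  (lamL_ge0 : forall i, 0 <= lamL i) (lamU_ge0 : forall i, 0 <= lamU i)
  (lam_sum : \sum_(i < m) (lamL i + lamU i) = 1)
  (mu_mult : multipliers g xbar mu)
  (kkt : kkt_set f g E Omega xbar lamL lamU mu 0) :
  (pseudo_quasi_gconvex f g E Omega xbar ->
    type2_quasi_weakly_pareto f E (feasible g Omega) xbar) /\
  (strict_pseudo_quasi_gconvex f g E Omega xbar ->
    [/\ type1_quasi_pareto f E (feasible g Omega) xbar,
        type2_quasi_pareto f E (feasible g Omega) xbar
      & type1_quasi_weakly_pareto f E (feasible g Omega) xbar]).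
Proof.
have [zL [zU [xs [b [w [zLP zUP xsP [bB wN] e0]]]]]] := kkt_certificate g_lip kkt.
have [mu0 mufin mug] := mu_mult.
have c0 : 0 <= \sum_(i < m) (lamL i * up (E i) + lamU i * lo (E i)).
  apply: sumr_ge0 => i _; rewrite addr_ge0// mulr_ge0//.
  exact: le_trans (E_ge0 i) (lo_le_up _).
have [Obar _] := xbar_feas.
(* Complementarity makes the constraints with [mu t != 0] active at [xbar]. *)
have active x nu : feasible g Omega x ->
    (forall t, g t x <= g t xbar -> dotp (xs t) nu <= 0) ->
    forall t, mu t != 0 -> dotp (xs t) nu <= 0.
  move=> [_ gx] xsnu t mt; apply: xsnu.
  have /eqP := mug t; rewrite mulf_eq0 (negbTE mt) /= => /eqP ->.
  exact: gx.
(* The multiplier sum is nonnegative, so the scalar inequalities that are the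
   premises of generalized convexity cannot all fail. *)
have incompatible x nu : feasible g Omega x ->
    polar (normal_cone Omega xbar) nu ->
    (forall t, g t x <= g t xbar -> dotp (xs t) nu <= 0) ->
    (forall b, eball b -> dotp b nu <= enorm (x - xbar)) ->
    (forall i, ~ 0 <= dotp (zL i) nu + up (E i) * enorm (x - xbar)) ->
    (forall i, ~ 0 <= dotp (zU i) nu + lo (E i) * enorm (x - xbar)) -> False.
  move=> Fx nuP xsnu bnu hL hU.
  have := multiplier_sum_ge0 mufin mu0 c0 e0 (active _ _ Fx xsnu) (bnu _ bB) (nuP _ wN).
  apply/negP; rewrite -ltNge; apply: weighted_sum_lt0 => // i; rewrite ltNge; exact/negP.
split=> [conv|sconv].
  split=> // -[x [Fx xdom]].
  have [nu nuP [hL hU xsnu bnu]] := conv x zL zU xs Fx.1 zLP zUP xsP.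
  apply: (incompatible x nu) => // i h; have [/= dL dU] := xdom i.
    by have := hL i h; lra.
  by have := hU i h; lra.
(* Under strict generalized convexity even weak domination refutes every premise. *)
have undominated x : feasible g Omega x -> x <> xbar ->
    ~ forall i, le_LU (f i x) (shifted f E xbar x i).
  move=> Fx xxbar xdom.
  have [nu nuP [hL hU xsnu bnu]] := sconv x zL zU xs Fx.1 xxbar zLP zUP xsP.
  apply: (incompatible x nu) => // i h; have [/= dL dU] := xdom i.
    by have := hL i h; lra.
  by have := hU i h; lra.
have t1 : type1_quasi_pareto f E (feasible g Omega) xbar.
  split=> // -[x [Fx xdom [k [_ xk]]]].
  apply: (undominated x Fx) xdom => xE; apply: xk.
  by apply: cint_ext; rewrite /= xE subrr enorm0 mul0r subr0.
split=> //; split=> // -[x].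
  case=> Fx xdom [k [kL kU]]; case: t1 => _; apply; exists x; split=> //.
  exists k; split; first exact: xdom.
  by move=> xk; move: kL; rewrite xk ltxx.
case=> Fx xdom; case: t1 => _; apply; exists x.
split=> // [i|]; first by case: (xdom i).
(* For [m = 0] the empty sum of the weights could not be 1. *)
have m_gt0 : (0 < m)%N.
  rewrite lt0n; apply/eqP => m0; have : (0 : R) = 1.
    by rewrite -lam_sum big1// => -[i im]; exfalso; rewrite m0 in im.
  by move/eqP; rewrite eq_sym oner_eq0.
by exists (Ordinal m_gt0).
Qed.
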